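(* There exist a probability space with probability measure $\mathbb{P}$, a sequence of events $(A_i)_{i=1}^\infty$ in it, and a computable function $\omega \colon \mathbb{N}^+ \to \mathbb{N}^+$ such that, for every $N \in \mathbb{N}^+$, \[ \sum_{i=1}^{\omega(N)} \mathbb{P}[A_i] \geq N, \] but for which there is no computable function $\phi \colon \mathbb{N} \times \mathbb{N}^+ \to \mathbb{N}^+$ satisfying: for all $m \in \mathbb{N}$ and $\ell \in \mathbb{N}^+$ there exists an integer $n \in [m, \phi(m, \ell)]$ such that \[ \mathbb{P}\left[\bigcup_{i=m+1}^n A_i\right] + \frac{1}{2^\ell} \geq \limsup_{j \to \infty} \frac{\left(\sum_{k=1}^j \mathbb{P}[A_k]\right)^2}{\sum_{i,k=1}^j \mathbb{P}[A_i A_k]}. \]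
   Context: $\mathbb{N}$ denotes the non-negative integers and $\mathbb{N}^+$ the positive integers. $A_i A_k$ denotes $A_i \cap A_k$, and $\sum_{i,k=1}^{j}$ is the sum over all pairs $(i,k)$ with $1 \le i,k \le j$. A union over an empty index range is the empty event. ''Computable'' means Turing computable (total recursive). *)

(* Defs.v *)
From HB Require Import structures.
From mathcomp Require Import all_boot all_order all_algebra.
From mathcomp Require Import all_classical all_reals all_analysis.

Set Implicit Arguments.
Unset Strict Implicit.
Unset Printing Implicit Defensive.

Definition posnat := {n : nat | (0 < n)%N}.

Coercion nat_of_posnat (n : posnat) : nat := val n.

(* Kleene's syntax for the k-ary partial recursive functions. *)
Inductive recfun : nat -> Type :=
| RZero : recfun 0
| RSucc : recfun 1
| RProj k (i : 'I_k) : recfun k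
| RComp j k (f : recfun j) (g : 'I_j -> recfun k) : recfun k
| RPrec k (f : recfun k) (g : recfun k.+2) : recfun k.+1
| RMu k (f : recfun k.+1) : recfun k.

(* [rec_graph e v y]: the function denoted by [e] is defined at [v], with value
   [y].  Recursion is on the first argument, h (0, v) = f v and
   h (t + 1, v) = g (t, h (t, v), v), with [s t] standing for h (t, v).
   Minimization is on the first argument, and requires [f] to be defined at all
   the points below the zero found. *)
Fixpoint rec_graph k (e : recfun k) : k.-tuple nat -> nat -> Prop :=
  match e in recfun k return k.-tuple nat -> nat -> Prop with
  | RZero => fun _ y => y = 0
  | RSucc => fun v y => y = (thead v).+1
  | RProj _ i => fun v y => y = tnth v i
  | RComp j _ f g => fun v y =>
      exists w : j.-tuple nat,
        (forall i, rec_graph (g i) v (tnth w i)) /\ rec_graph f w y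
  | RPrec _ f g => fun v y =>
      exists s : nat -> nat,
        [/\ rec_graph f [tuple of behead v] (s 0),
            forall t, (t < thead v)%N ->
              rec_graph g [tuple of t :: s t :: behead v] (s t.+1)
          & y = s (thead v)]
  | RMu _ f => fun v y =>
      rec_graph f [tuple of y :: v] 0 /\
      forall t, (t < y)%N -> exists z, rec_graph f [tuple of t :: v] z.+1
  end.

Definition total_recursive k (h : k.-tuple nat -> nat) : Prop :=
  exists e : recfun k, forall v, rec_graph e v (h v).

(* A function with arguments in the (decidable) set of positive integers is
   computable when it is the restriction of a total recursive function. *)
Definition computable_pos (f : posnat -> posnat) : Prop :=
  exists h : 1.-tuple nat -> nat,
    total_recursive h /\ forall N : posnat, h [tuple N : nat] = f N.

Definition computable_nat_pos (f : nat -> posnat -> posnat) : Prop :=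
  exists h : 2.-tuple nat -> nat,
    total_recursive h /\
    forall (m : nat) (l : posnat), h [tuple m; l : nat] = f m l.

(* The sum over k = 1 .. j of P[A_k], squared, over the sum over
   i, k = 1 .. j of P[A_i A_k].  The quotient is 0 by convention if the
   denominator vanishes, that is, if A_1, .., A_j are all null. *)
Definition kochen_stone_ratio (R : realType) (d : measure_display)
    (T : measurableType d) (P : probability T R) (A : nat -> set T) (j : nat) :
    R :=
  ((\sum_(1 <= k < j.+1) fine (P (A k))) ^+ 2 /
   \sum_(1 <= i < j.+1) \sum_(1 <= k < j.+1) fine (P (A i `&` A k)%classic))%R.

(* Main.v *)
(* The events need not be computable, so it suffices to diagonalize against
   the countably many recursive functions.  On nat with a fully supported
   probability P, choose l_c with 2^-l_c < P{c}, let F c be the value at (0, l_c)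
   of the c-th recursive function, and let A_i be the set of the points c with
   F c < i (shifting c by one to add a point of mass at least 1/2 to each A_i).  The A_i increase to the
   whole space, so P(A_i) tends to 1 and, by Cesaro, so does the Kochen-Stone
   ratio; but A_1, .., A_(F c) all miss c, so the c-th recursive function is not
   a valid rate at m = 0, l = l_c. *)
Require Import Defs.
From HB Require Import structures.
From mathcomp Require Import all_boot all_order all_algebra.
From mathcomp Require Import all_classical all_reals all_analysis.
From mathcomp Require Import lra.
Import Order.TTheory GRing.Theory Num.Theory.
Import numFieldNormedType.Exports.

(** Determinism identifies the value picked by the diagonal function with that of the total function
    denoted by the program. *)
Lemma rec_graph_functional k (e : recfun k) v y y' :
  rec_graph e v y -> rec_graph e v y' -> y = y'.
Proof.
elim: e v y y' => {k} [||k i|j k f IHf g IHg|k f IHf g IHg|k f IHf] v y y' /=.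
- by move=> -> ->.
- by move=> -> ->.
- by move=> -> ->.
- move=> [w [gw fw]] [w' [gw' fw']].
  have ww' : w = w' by apply: eq_from_tnth => i; exact: IHg (gw i) (gw' i).
  by rewrite -ww' in fw'; exact: IHf fw fw'.
- move=> [s [s0 sS ->]] [s' [s'0 s'S ->]].
  suff: forall t, (t <= thead v)%N -> s t = s' t by exact.
  elim=> [|t IHt] tv; first exact: IHf s0 s'0.
  have := s'S t tv; rewrite -(IHt (ltnW tv)) => s'tS.
  exact: IHg (sS t tv) s'tS.
- move=> [fy ltfy] [fy' ltfy'].
  case: (ltngtP y y') => // [/ltfy' [z fz]|/ltfy [z fz]].
  + by have := IHf _ _ _ fy fz.
  + by have := IHf _ _ _ fy' fz.
Qed.

(** Trees over [nat] are countable, so decoding them enumerates the programs of each arity. Leaves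
    code projections; labels 0, 1, 2 and [j.+3] code the base functions, primitive recursion,
    minimization and composition with [j] inner functions. Ill-formed trees decode to a default
    available in every arity. *)
Fixpoint recfun_of_tree (t : GenTree.tree nat) (k : nat) : recfun k :=
  let dflt m := RMu (RProj (@ord0 m)) in
  match t with
  | GenTree.Leaf n => if insub n is Some i then RProj i else dflt k
  | GenTree.Node n ts =>
    let sub i := nth dflt (map recfun_of_tree ts) i in
    match n, k with
    | 0, 0 => RZero
    | 0, 1 => RSucc
    | 1, k'.+1 => RPrec (sub 0 k') (sub 1 k'.+2)
    | 2, k' => RMu (sub 0 k'.+1)
    | j.+3, k' => RComp (sub 0 j) (fun i : 'I_j => sub i.+1 k')
    | _, k' => dflt k'
    end
  end.

Lemma recfun_of_tree_surj k (e : recfun k) : exists t, recfun_of_tree t k = e.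
Proof.
elim: e => {k} [||k i|j k f [tf Ef] g /choice[tg Eg]|k f [tf Ef] g [tg Eg]
  |k f [tf Ef]].
- by exists (GenTree.Node 0 [::]).
- by exists (GenTree.Node 0 [::]).
- by exists (GenTree.Leaf (i : nat)); rewrite /= valK.
- exists (GenTree.Node j.+3 (tf :: [seq tg i | i <- enum 'I_j])).
  rewrite /= Ef; congr RComp; apply/funext => i.
  rewrite -map_comp (nth_map i) ?size_enum_ord //.
  by rewrite nth_ord_enum /= Eg.
- by exists (GenTree.Node 1 [:: tf; tg]); rewrite /= Ef Eg.
- by exists (GenTree.Node 2 [:: tf]); rewrite /= Ef.
Qed.

Lemma total_recursive_diagonal k (x : nat -> k.-tuple nat) :
  exists F : nat -> nat,
    forall h, total_recursive h -> exists c, h (x c) = F c.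
Proof.
pose E c := recfun_of_tree (odflt (GenTree.Leaf (0 : nat)) (unpickle c)) k.
(* [F c] is the value of program [c] at [x c], or 0 if it diverges there; this is a classical
   choice, not a computation. *)
exists (fun c => xget 0 [set y | rec_graph (E c) (x c) y]%classic) => h [e eh].
have [t te] := recfun_of_tree_surj _ e.
exists (pickle t).
have Et : E (pickle t) = e by rewrite /E pickleK /= te.
case: xgetP => [y _ /=|/(_ (h (x (pickle t)))) /=]; rewrite Et.
  by move=> ey; exact: rec_graph_functional (eh _) ey.
by move=> /(_ (eh _)).
Qed.

Lemma posnat_double_gt0 (N : posnat) : (0 < N.*2)%N.
Proof. by rewrite double_gt0; exact: valP. Qed.

(** This serves as [omega]: [N.*2] events of probability at least 1/2 have probabilities summing to
    at least [N]. *)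
Definition posnat_double (N : posnat) : posnat :=
  exist _ N.*2 (posnat_double_gt0 N).

Lemma computable_posnat_double : computable_pos posnat_double.
Proof.
(* Two successors applied to the argument of index 1, which in [RPrec] is the previous value. *)
pose SS := RComp RSucc (fun _ : 'I_1 =>
  RComp RSucc (fun _ : 'I_1 => RProj (lift ord0 (@ord0 0)))).
exists (fun v => (thead v).*2); split=> //.
exists (RPrec RZero SS) => v; exists double; split=> // t _.
exists [tuple t.*2.+1]; split=> // i.
rewrite (ord1 i); exists [tuple t.*2]; split=> // i'.
by rewrite (ord1 i').
Qed.

Local Open Scope classical_set_scope.
Local Open Scope ring_scope.

Lemma limn_esup_ge_cvg (R : realType) (u v : (\bar R)^nat) (l : \bar R) :
  (forall n, u n <= v n)%E -> u @ \oo --> l -> (l <= limn_esup v)%E.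
Proof.
move=> uv ul; rewrite limn_esup_lim -(cvg_lim (@ereal_hausdorff R) ul).
apply: lee_lim; [by apply/cvg_ex; exists l|exact: is_cvg_esups|].
apply: nearW => n; apply: (le_trans (uv n)).
by apply: ereal_sup_ubound; exists n => /=.
Qed.

(** Bounding P(A_i A_k) by P(A_k) gives [D <= j * S], hence [S ^+ 2 / D >= S / j]. The diagonal
    terms give [S <= D], so [D] is positive when [S] is. *)
Lemma kochen_stone_ratio_ge_mean (R : realType) (d : measure_display)
    (T : measurableType d) (P : probability T R) (A : nat -> set T) (j : nat) :
  (forall i, (1 <= i)%N -> measurable (A i)) ->
  j%:R^-1 * \sum_(1 <= k < j.+1) fine (P (A k)) <= kochen_stone_ratio P A j.
Proof.
move=> mA; rewrite /kochen_stone_ratio.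
set D := (X in _ / X); set S := (X in X ^+ 2).
have S0 : 0 <= S by apply: sumr_ge0 => k _; rewrite fine_ge0 ?measure_ge0.
have leSD : S <= D.
  rewrite /S /D big_nat [leRHS]big_nat; apply: ler_sum => i ij.
  rewrite (bigD1_seq i) ?mem_index_iota ?iota_uniq //= setIid lerDl.
  by apply: sumr_ge0 => k _; rewrite fine_ge0 ?measure_ge0.
have leDjS : D <= j%:R * S.
  have -> : j%:R * S = \sum_(1 <= i < j.+1) S.
    by rewrite sumr_const_nat subn1 /= mulr_natl.
  rewrite /D big_nat [leRHS]big_nat; apply: ler_sum => i /andP[i1 _].
  rewrite /S big_nat [leRHS]big_nat; apply: ler_sum => k /andP[k1 _].
  have [mAi mAk] := (mA i i1, mA k k1).
  rewrite fine_le ?measureIr ?fin_num_measure //; exact: measurableI.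
have [S_le0|S_gt0] := leP S 0.
  rewrite (le_trans (mulr_ge0_le0 _ S_le0)) // divr_ge0 ?sqr_ge0 //.
  exact: le_trans leSD.
have D_gt0 := lt_le_trans S_gt0 leSD.
have j_gt0 : 0 < j%:R :> R.
  by move: (lt_le_trans D_gt0 leDjS); rewrite pmulr_lgt0.
by rewrite ler_pdivlMr // -mulrA ler_pdivrMl // expr2 mulrCA ler_pM2l.
Qed.

Lemma limn_esup_kochen_stone_ratio_ge1 (R : realType) (d : measure_display)
    (T : measurableType d) (P : probability T R) (A : nat -> set T) :
  (forall i, (1 <= i)%N -> measurable (A i)) -> P \o A @ \oo --> 1%E ->
  (1 <= limn_esup (fun j => (kochen_stone_ratio P A j)%:E))%E.
Proof.
move=> mA PA1.
pose u j : R := j%:R^-1 * \sum_(1 <= k < j.+1) fine (P (A k)).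
apply: (@limn_esup_ge_cvg _ (EFin \o u)).
  by move=> n; rewrite lee_fin; exact: kochen_stone_ratio_ge_mean.
apply: cvg_EFin; first exact: nearW.
(* The library's arithmetic means start at index 0, those of [u] at 1. *)
rewrite -(cvg_shiftS u).
have : (fun k => fine (P (A k.+1))) @ \oo --> (1 : R).
  by move/fine_cvgP : PA1 => [_]; rewrite -(cvg_shiftS (fine \o _)).
move=> /cesaro; apply: cvg_trans; apply: near_eq_cvg; apply: nearW => n /=.
by rewrite /u /arithmetic_mean /series /= big_add1.
Qed.

(** The Poisson law of rate 1/2 charges every point, and its mass at 0 is exp(-1/2) >= 1 - 1/2. *)
Lemma exists_full_support_probability (R : realType) :
  exists2 P : probability nat R,
    forall n, (0 < P [set n])%E & ((2^-1)%:E <= P [set 0%N])%E.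
Proof.
have half_gt0 : 0 < 2^-1 :> R by rewrite invr_gt0.
have PE n : poisson_prob 2^-1 0 [set n] =
    (2^-1 ^+ n * n`!%:R^-1 * expR (- 2^-1) : R)%:E.
  rewrite /poisson_prob half_gt0 esum_set1 ?lee_fin ?poisson_pmf_ge0 //.
  by rewrite /poisson_pmf half_gt0.
exists (poisson_prob 2^-1 0) => [n|] /=; rewrite PE.
  by rewrite lte_fin !mulr_gt0 ?exprn_gt0 ?invr_gt0 ?ltr0n ?fact_gt0 ?expR_gt0.
rewrite lee_fin expr0 fact0 invr1 !mul1r.
by apply: le_trans (expR_ge1Dx _); lra.
Qed.

Theorem theorem4p9 (R : realType) :
  exists (d : measure_display) (T : measurableType d) (P : probability T R)
    (A : nat -> set T) (omega : posnat -> posnat),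
    [/\ forall i : nat, (1 <= i)%N -> measurable (A i),
        computable_pos omega,
        forall N : posnat,
          ((N%:R)%:E <= \sum_(1 <= i < (omega N).+1) P (A i))%E
      & ~ exists phi : nat -> posnat -> posnat,
            computable_nat_pos phi /\
            forall (m : nat) (l : posnat),
              exists n : nat,
                (m <= n <= phi m l)%N /\
                (limn_esup (fun j : nat => (kochen_stone_ratio P A j)%:E) <=
                 P (\bigcup_(i in [set i | (m.+1 <= i <= n)%N]) A i)
                 + (1 / 2 ^+ l)%:E)%E].
Proof.
have [P P_gt0 P0_ge] := exists_full_support_probability R.
have P_fin B : P B \is a fin_num by exact: fin_num_measure.
(* The exponent is written [l.+1] so that it can serve as a positive precision. *)
have /choice[l ltlP] : forall c, exists l : nat,
    ((1 / 2 ^+ l.+1)%:E < P [set c])%E.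
  move=> c; have P_gt0r : 0 < fine (P [set c]).
    by rewrite fine_gt0 // P_gt0 -ge0_fin_numE ?P_fin.
  have [n _ /(_ n.+1 (leqnSn n)) ltn] :=
    near_infty_natSinv_expn_lt (PosNum P_gt0r).
  by exists n; rewrite -(fineK (P_fin _)) lte_fin.
have [F Fdiag] :=
  total_recursive_diagonal _ (fun c => [tuple 0%N; (l c.+1).+1]).
(* Point 0 lies in every event; point [c'.+1] enters only after index [F c'], so it is the witness
   against program [c']. *)
pose A i := [set c | if c is c'.+1 then (F c' < i)%N else true].
have PA_ge i : ((2^-1)%:E <= P (A i))%E.
  apply: (le_trans P0_ge); apply: le_measure; rewrite ?inE //.
  by move=> _ ->.
have A_homo : {homo A : i j / (i <= j)%N >-> i `<=` j}.
  by move=> i j ij [//|c] /= /leq_trans; exact.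
exists default_measure_display, nat, P, A, posnat_double; split=> //.
- exact: computable_posnat_double.
- move=> N.
  apply: (@le_trans _ _ (\sum_(1 <= i < (posnat_double N).+1) (2^-1)%:E)%E).
    rewrite sumEFin sumr_const_nat subn1 /= lee_fin [in leRHS]/nat_of_posnat /=.
    by rewrite -mul2n mulrnA -[_ *+ 2]mulr_natl mulfV.
  by apply: lee_sum.
case=> phi [[h [hrec hphi]] hlim].
have [c hc] := Fdiag h hrec.
pose lc : posnat := exist _ (l c.+1).+1 (ltn0Sn _).
have phiF : phi 0%N lc = F c :> nat by rewrite -hphi -hc.
have [n [/andP[_ nphi]]] := hlim 0%N lc.
apply/negP; rewrite -ltNge.
apply: (@lt_le_trans _ _ 1%E); last first.
  apply: limn_esup_kochen_stone_ratio_ge1 => //.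
  have -> : 1%E = P (\bigcup_i A i).
    rewrite -(probability_setT P); congr (P _).
    apply/seteqP; split=> // -[|c'] _.
      by exists 0%N.
    by exists (F c').+1 => /=.
  by apply: nondecreasing_cvg_mu => // i j ij; apply/subsetPset; exact: A_homo.
set U := \bigcup_(_ in _) _.
(* Every index in the union is at most [n <= phi 0 lc = F c], too small for [c.+1] to have
   entered. *)
have UC : U `<=` ~` [set c.+1].
  move=> x [i /= /andP[_ lein]] Ax xc; move: Ax; rewrite xc /= -phiF ltnNge.
  by rewrite (leq_trans lein nphi).
have PU : (P U <= 1 - P [set c.+1])%E.
  by rewrite -probability_setC //; apply: le_measure; rewrite ?inE.
apply: (le_lt_trans (leeD2r _ PU)).
rewrite -(fineK (P_fin _)) -EFinB -EFinD lte_fin.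
have := ltlP c.+1; rewrite -(fineK (P_fin _)) lte_fin /=.
by set x := _ / _; lra.
Qed.
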